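(* Let $D\subset\mathbb{R}^2$ be a unit disk and let $\kappa>0$, $\kappa\ne 1$. As $L\to-\infty$, $$|\mathcal{T}_D(\phi_{L,n},\phi_{L,n'})|=\begin{cases}O(2^{-2L}) & \text{if } \phi_{L,n} \text{ and } \phi_{L,n'} \text{ overlap (their supports intersect)},\\ O(2^{-L}) & \text{otherwise},\end{cases}$$ for $n,n'\in\mathbb{Z}^2$, the implied constants being independent of $L,n,n'$.
   Context: The bilinear form. Put $\lambda=\frac{\kappa+1}{2(\kappa-1)}$. For a bounded domain $D$ with $\mathcal{C}^2$ boundary and outward unit normal $\nu$, the Neumann–Poincaré operator on $L^2(\partial D)$ is $$\mathcal{K}_D^*[h](x)=\frac{1}{2\pi}\int_{\partial D}\frac{\langle x-y,\nu_x\rangle}{|x-y|^2}\,h(y)\,ds(y).$$ The operator $\lambda I-\mathcal{K}_D^*$ is invertible on $L^2(\partial D)$ with bounded inverse. Define $$\mathcal{T}_D(f,g)=\int_{\partial D} g(x)\,(\lambda I-\mathcal{K}_D^* )^{-1}\Big[\frac{\partial f}{\partial\nu}\Big](x)\,ds(x)$$ for $f$ of class $H^2$ and $g$ of class $H^1$ in a neighborhood of $\partial D$, boundary values being understood in the sense of traces. The wavelet basis. $\tilde\phi\in\mathcal{C}_0^r(\mathbb{R})$ (compactly supported, class $\mathcal{C}^r$), $r\ge 2$, is a one-dimensional orthonormal scaling function generating a multiresolution analysis of $L^2(\mathbb{R})$, and $\tilde\psi\in L^2(\mathbb{R})$ is an associated wavelet, orthogonal to $\tilde\phi$, with $p>2$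 zero moments. Set $\phi(x_1,x_2)=\tilde\phi(x_1)\tilde\phi(x_2)$ and $\phi_{L,n}(x)=2^{-L}\phi(2^{-L}x-n)$ for $L\in\mathbb{Z}$, $n\in\mathbb{Z}^2$. *)

(* Defs.v *)
From HB Require Import structures.
From mathcomp Require Import all_boot all_order all_algebra.
From mathcomp Require Import all_classical all_reals all_analysis.
From mathcomp Require Import measurable_realfun ring lra.
Set Implicit Arguments.
Unset Strict Implicit.
Unset Printing Implicit Defensive.
Import Order.TTheory GRing.Theory Num.Theory.
Import numFieldNormedType.Exports.
Local Open Scope classical_set_scope.
Local Open Scope ring_scope.

Definition tsupp (R : realType) (T : topologicalType) (f : T -> R) : set T :=
  closure [set x | f x != 0].

Definition Cclass (R : realType) (r : nat) (f : R -> R) : Prop :=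
  (forall k, (k < r)%N -> forall x, derivable (derive1n k f) x 1) /\
  continuous (derive1n r f).

Definition Cclass_compact (R : realType) (r : nat) (f : R -> R) : Prop :=
  Cclass r f /\ compact (tsupp f).

(** ** Multiresolution analyses of L^2(R) *)

(* Elements of L^2(R) are represented by functions; a closed subspace is a set
   of such functions, and [l2_closed] makes it stable under a.e. equality. *)
Section multiresolution.
Variable R : realType.
Local Notation mu := (@lebesgue_measure R).
Implicit Types (f g : R -> R) (W : set (R -> R)) (V : int -> set (R -> R)).

Definition l2_inner f g : R := \int[mu]_x (f x * g x).

Definition l2_dist f g : \bar R := ('N[mu]_(2%:E)[EFin \o (f \- g)%R])%E.

Definition l2_closed W : Prop :=
  forall f, f \in Lfun mu 2%:E ->
    (forall eps : R, 0 < eps -> exists2 g, W g & (l2_dist f g < eps%:E)%E) ->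
  W f.

Definition l2_closed_subspace W : Prop :=
  [/\ forall f, W f -> f \in Lfun mu 2%:E,
      W (fun=> 0),
      forall (a : R) f g, W f -> W g -> W (fun x => a * f x + g x)
    & l2_closed W].

Definition orthonormal_basis (e : int -> R -> R) W : Prop :=
  [/\ forall k, W (e k),
      forall k l, l2_inner (e k) (e l) = (k == l)%:R
    & forall f, W f -> forall eps : R, 0 < eps ->
        exists (s : seq int) (a : int -> R),
          (l2_dist f (fun x => \sum_(k <- s) a k * e k x)%R < eps%:E)%E].

Definition translates f (k : int) : R -> R := fun x => f (x - k%:~R).

(* Indexing convention: [V j] is spanned by the dilates at scale 2 ^ j, so the
   spaces get coarser as j increases. *)
Definition multiresolution V : Prop :=
  [/\ forall j, l2_closed_subspace (V j),
      forall j, V (j + 1) `<=` V j,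
      forall j f, V j f <-> V (j - 1) (fun x => f (2 * x)),
      forall (k : int) f, V 0 f <-> V 0 (translates f k)
    & (forall f, (forall j, V j f) -> f = (fun=> 0) %[ae mu]) /\
      (forall f, f \in Lfun mu 2%:E -> forall eps : R, 0 < eps ->
         exists j, exists2 g, V j g & (l2_dist f g < eps%:E)%E)].

Definition orthonormal_scaling_function V (phi : R -> R) : Prop :=
  orthonormal_basis (translates phi) (V 0).

Definition detail_space V : set (R -> R) :=
  [set f | V (- 1) f /\ forall g, V 0 g -> l2_inner f g = 0].

Definition associated_wavelet V (psi : R -> R) : Prop :=
  orthonormal_basis (translates psi) (detail_space V).

Definition zero_moments (p : nat) (psi : R -> R) : Prop :=
  forall k, (k < p)%N ->
    mu.-integrable setT (fun x => (x ^+ k * psi x)%:E) /\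
    \int[mu]_x (x ^+ k * psi x) = 0.

(* phi_{L,n}(x) = 2^-L phi(2^-L x - n), phi(x1,x2) = phi~(x1) phi~(x2) *)
Definition phi2 (phit : R -> R) (x : R * R) : R := phit x.1 * phit x.2.

Definition phiLn (phit : R -> R) (L : int) (n : int * int) (x : R * R) : R :=
  2 ^ (- L) * phi2 phit (2 ^ (- L) * x.1 - n.1%:~R, 2 ^ (- L) * x.2 - n.2%:~R).

End multiresolution.

(** ** The Neumann-Poincare operator and the bilinear form *)

(* The norm of the library on R * R is the sup norm, hence this inner product. *)
Definition dot (R : realType) (x y : R * R) : R := x.1 * y.1 + x.2 * y.2.

Definition boundary (T : topologicalType) (D : set T) : set T :=
  closure D `\` interior D.

(* [nu] is the outward unit normal on the boundary of D; [ds] is the arc length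
   measure of that boundary, seen as a measure on the plane. *)
Section neumann_poincare.
Variables (R : realType) (D : set (R * R)) (nu : R * R -> R * R).
Variable ds : {measure set (R * R) -> \bar R}.
Implicit Types (f g h : R * R -> R) (lambda kappa : R).

Definition neumann_poincare h : R * R -> R := fun x =>
  (2 * pi)^-1 *
  \int[ds]_(y in boundary D) (dot (x - y) (nu x) / dot (x - y) (x - y) * h y).

(* [h] is a representative of (lambda I - K_D^* )^-1 [F] in L^2(ds). *)
Definition np_resolvent_graph lambda F h : Prop :=
  h \in Lfun ds 2%:E /\
  (fun x => lambda * h x - neumann_poincare h x) = F %[ae ds in boundary D].

(* Any two representatives agree a.e. when lambda I - K_D^* is invertible. *)
Definition np_resolvent lambda F : R * R -> R :=
  xget (fun=> 0) [set h | np_resolvent_graph lambda F h].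

Definition normal_derivative f : R * R -> R := fun x => 'D_(nu x) f x.

Definition np_lambda kappa : R := (kappa + 1) / (2 * (kappa - 1)).

(* For f of class C^2 and g of class C^1 near the boundary of D, the traces of
   the normal derivative of f and of g are the pointwise boundary values. *)
Definition np_form kappa f g : R :=
  \int[ds]_(x in boundary D)
    (g x * np_resolvent (np_lambda kappa) (normal_derivative f) x).

End neumann_poincare.

(** ** The unit disk *)

Section unit_disk.
Variables (R : realType) (c : R * R).

Definition unit_disk : set (R * R) := [set x | dot (x - c) (x - c) < 1].

Definition unit_circle : set (R * R) := [set x | dot (x - c) (x - c) = 1].

Let dot_continuous : continuous (fun x : R * R => dot (x - c) (x - c)).
Proof.
move=> x; rewrite /dot.
have h1 : continuous (fun y : R * R => (y - c).1).
  by move=> y; apply: cvgB; [exact: cvg_fst | exact: cvg_cst].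
have h2 : continuous (fun y : R * R => (y - c).2).
  by move=> y; apply: cvgB; [exact: cvg_snd | exact: cvg_cst].
by apply: cvgD; apply: cvgM; [exact: h1|exact: h1|exact: h2|exact: h2].
Qed.

Lemma boundary_unit_disk : boundary unit_disk = unit_circle.
Proof.
have disk_open : open unit_disk.
  rewrite (_ : unit_disk = (fun x => dot (x - c) (x - c)) @^-1` [set t | t < 1]);
    last by [].
  by apply: open_comp; [move=> x _; exact: dot_continuous | exact: open_lt].
rewrite /boundary (iffLR (interior_id _) disk_open).
apply/seteqP; split => [x [cx ndx]|x cx].
  apply/eqP; rewrite eq_le; apply/andP; split; last by rewrite leNgt; apply/negP.
  have : closed [set y : R * R | dot (y - c) (y - c) <= 1].
    rewrite (_ : [set _ | _] =
      (fun x => dot (x - c) (x - c)) @^-1` [set t | t <= 1]); last by [].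
    by apply: preimage_closed; [move=> y _; exact: dot_continuous | exact: closed_le].
  move=> cl; apply: cl; apply: closureS cx => y; exact: ltW.
split; last by rewrite /unit_disk/= cx ltxx.
have xcvg : (c + t *: (x - c)) @[t --> (1 : R)^'-] --> x.
  rewrite -[X in _ --> X](_ : c + 1 *: (x - c) = x); last first.
    by rewrite scale1r addrC subrK.
  apply: cvg_at_left_filter; apply: cvgD; first exact: cvg_cst.
  by apply: cvgZr_tmp; exact: cvg_id.
move=> B /xcvg Bx.
have [t [Bt /andP[t0 t1]]] : exists t : R, B (c + t *: (x - c)) /\ 0 <= t < 1.
  near (1 : R)^'- => t; exists t; split; first by near: t.
  by apply/andP; split; near: t; [apply: nbhs_left_ge | exact: nbhs_left_lt].
exists (c + t *: (x - c)); split => //.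
rewrite /unit_disk /= addrC addKr.
have -> : dot (t *: (x - c)) (t *: (x - c)) = t ^+ 2 * dot (x - c) (x - c).
  by rewrite /dot /= /GRing.scale /=; ring.
by rewrite cx mulr1 expr2; nra.
Unshelve. all: by end_near. Qed.

Definition disk_normal (x : R * R) : R * R := x - c.

Definition disk_param (t : R) : R * R := (c.1 + cos t, c.2 + sin t).

Lemma measurable_disk_param : measurable_fun [set: measurableTypeR R] disk_param.
Proof.
apply/measurable_fun_pairP; split; apply: continuous_measurable_fun => t;
  apply: cvgD; [exact: cvg_cst|exact: continuous_cos|exact: cvg_cst|
                exact: continuous_sin].
Qed.

(* [disk_param] has unit speed and is injective on [0, 2 pi[, so arc length is
   the image of Lebesgue measure on this interval. *)
Definition disk_arclength : set (R * R) -> \bar R :=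
  pushforward
    (mrestr (@lebesgue_measure R) (measurable_itv `[(0 : R), 2 * pi[))
    disk_param.

HB.instance Definition _ := Measure.copy disk_arclength
  (measure_function_pushforward__canonical__measure_function_Measure
     (mrestr (@lebesgue_measure R) (measurable_itv `[(0 : R), 2 * pi[))
     measurable_disk_param).

End unit_disk.

(* Main.v *)
(** On the unit circle the kernel <x - y, nu_x> / |x - y|^2 equals 1/2 off the
    diagonal, so K^* h is the constant (4 pi)^-1 \int h.  Integrating
    lambda h - K^* h = F over the circle, and using
    lambda - 1/2 = (kappa - 1)^-1, gives
      lambda T(f, g) = \int g F + (kappa - 1) (4 pi)^-1 (\int F) (\int g),
    where F is the normal derivative of f.  With a = 2^-L, the functions
    g = phi_{L,n'} and F are O(a) and O(a^2), and both live in squares of side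
    O(1/a), which the circle meets in length O(1/a).  Hence the last term is
    O(a), while \int g F is O(a^2), and zero when the supports are disjoint. *)

Require Import Defs.
From mathcomp Require Import all_boot all_order all_algebra.
From mathcomp Require Import all_classical all_reals all_analysis.
From mathcomp Require Import measurable_realfun ring lra.
Import Order.TTheory GRing.Theory Num.Theory.
Import numFieldNormedType.Exports.
Local Open Scope classical_set_scope.
Local Open Scope ring_scope.

Set Implicit Arguments.
Unset Strict Implicit.

(** * Length of the part of a unit circle lying in a small square *)

Section arclength.
Variable R : realType.
Implicit Types (a b c x y : R * R) (t s w rho : R).

(** For w > 0 the mean value theorem gives sin w = w cos xi with 0 < xi < w, and cos xi >= cos (pi /
    4) >= 1/2. The last bound follows from 2 cos^2 (pi / 4) = 1, the double-angle formula at pi /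
    4. *)
Lemma half_le_sin w : 0 <= w -> w <= pi / 4 -> w / 2 <= sin w.
Proof.
move=> w0 wpi.
have pi_gt0 := pi_gt0 R.
have [->|wneq0] := eqVneq w 0; first by rewrite mul0r sin0.
have w_gt0 : 0 < w by rewrite lt_neqAle eq_sym wneq0.
have sinC : {within `[0, w], continuous (@sin R)}.
  by apply: continuous_subspaceT => u; exact: continuous_sin.
have [xi /[!in_itv]/= /andP[xi0 xiw]] :=
  MVT w_gt0 (fun u _ => is_derive_sin u) sinC.
rewrite sin0 !subr0 => ->.
have cos_xi : cos (pi / 4 : R) <= cos xi.
  by rewrite ltW// ltr_cos ?in_itv/=; lra.
have cos_q0 : 0 <= cos (pi / 4 : R).
  by apply: cos_ge0_pihalf; lra.
have cos_q : cos (pi / 4 : R) ^+ 2 *+ 2 = 1.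
  have := cos_mulr2n (pi / 4 : R).
  rewrite (_ : (pi / 4) *+ 2 = pi / 2); last by rewrite mulr2n; field.
  by rewrite cos_pihalf => /esym/eqP; rewrite subr_eq0 => /eqP.
have : 1 / 2 <= cos (pi / 4 : R) by move: cos_q; rewrite mulr2n expr2; nra.
nra.
Qed.

(* |e^(it) - e^(is)| = 2 |sin ((s - t) / 2)|. *)
Lemma arc_le_chord t s rho : 0 <= s - t -> s - t <= pi / 2 ->
  `|cos t - cos s| <= 2 * rho -> `|sin t - sin s| <= 2 * rho ->
  s - t <= 8 * rho.
Proof.
move=> ts0 tspi dcos dsin.
have rho0 : 0 <= rho.
  by have : 0 <= 2 * rho := le_trans (normr_ge0 _) dcos; lra.
set w := (s - t) / 2.
have sinw : w / 2 <= sin w by apply: half_le_sin; rewrite /w; lra.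
have chord : 4 * sin w ^+ 2 = (cos t - cos s) ^+ 2 + (sin t - sin s) ^+ 2.
  have cos_st : cos (s - t) = 1 - 2 * sin w ^+ 2.
    rewrite (_ : s - t = w *+ 2); last by rewrite mulr2n /w; field.
    by rewrite cos_mulr2n cos2sin2; ring.
  have := cos2Dsin2 s; have := cos2Dsin2 t.
  by move: cos_st; rewrite cosB; nra.
have sqr_le (d : R) : `|d| <= 2 * rho -> d ^+ 2 <= 4 * rho ^+ 2.
  move=> dle; rewrite -real_normK ?num_real// (_ : 4 * _ = (2 * rho) ^+ 2);
    last by ring.
  by rewrite lerXn2r// nnegrE; lra.
have sw0 : 0 <= sin w by apply: le_trans sinw; rewrite /w; lra.
(* The squared chord is at most 8 rho^2, so sin w <= sqrt 2 rho, rounded up to 2 rho. With w / 2 <=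
   sin w this produces the constant 8. *)
have sw : sin w <= 2 * rho.
  have := sqr_le _ dcos; have := sqr_le _ dsin; move: chord; nra.
by move: sinw sw; rewrite /w; lra.
Qed.

(** The set lies in [t - d, t + d] for any of its points t. Centring at a point of the set rather
    than starting from its infimum costs the factor 2. *)
Lemma lebesgue_measure_le_spread (A : set R) (d : R) : 0 <= d ->
  measurable A -> (forall t s, A t -> A s -> t <= s -> s - t <= d) ->
  (lebesgue_measure A <= (2 * d)%:E)%E.
Proof.
move=> d0 mA spread.
have [->|/set0P[t At]] := eqVneq A set0; first by rewrite measure0 lee_fin; lra.
have sub : A `<=` `[t - d, t + d]%classic.
  move=> s As /=; rewrite in_itv /=.
  have [ts|st] := leP t s; first by have := spread _ _ At As ts; lra.
  by have := spread _ _ As At (ltW st); lra.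
apply: (@le_trans _ _ (lebesgue_measure `[t - d, t + d]%classic)).
  by apply: le_measure => //; rewrite inE.
rewrite lebesgue_measure_itv /= lte_fin; case: ifPn => _.
  by rewrite -EFinB lee_fin; lra.
by rewrite lee_fin; lra.
Qed.

Definition box a rho : set (R * R) :=
  [set x | `|x.1 - a.1| <= rho /\ `|x.2 - a.2| <= rho].

Lemma measurable_box a rho : measurable (box a rho).
Proof.
rewrite (_ : box a rho = `[a.1 - rho, a.1 + rho] `*` `[a.2 - rho, a.2 + rho]).
  exact: measurableX.
by apply/seteqP; split=> x; rewrite /box /= !in_itv /= !ler_distl => -[].
Qed.

(** [arc_le_chord] reaches only up to a quarter turn, so [0, 2 pi[ is covered by four of them.
    Within one quarter, two parameters landing in the square differ by at most 8 rho, so each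
    quarter contributes at most 16 rho. *)
Lemma disk_arclength_box c a rho : 0 <= rho ->
  (disk_arclength c (box a rho) <= (64 * rho)%:E)%E.
Proof.
move=> rho0.
set E := disk_param c @^-1` box a rho.
have mE : measurable E.
  rewrite -[E]setTI; apply: (measurable_disk_param c) => //.
  exact: measurable_box.
pose Q (k : nat) := E `&` `[k%:R * (pi / 2), k.+1%:R * (pi / 2)]%classic.
have mQ k : measurable (Q k) by apply: measurableI.
have Qle k : (lebesgue_measure (Q k) <= (16 * rho)%:E)%E.
  rewrite (_ : 16 * rho = 2 * (8 * rho)); last by ring.
  apply: lebesgue_measure_le_spread => //; first by lra.
  move=> t s [[/= t1 t2]] /[!in_itv]/= /andP[kt tk].
  move=> [[/= s1 s2]] /[!in_itv]/= /andP[ks sk] ts.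
  have tri (x y z w : R) : `|z + x - w| <= rho -> `|z + y - w| <= rho ->
      `|x - y| <= 2 * rho.
    by rewrite !ler_norml; lra.
  apply: arc_le_chord;
    [by rewrite subr_ge0| |exact: tri t1 s1|exact: tri t2 s2].
  by move: kt sk; rewrite -(natr1 k) (mulrDl k%:R) mul1r; lra.
have Ecover : E `&` `[0, 2 * pi[%classic `<=` (Q 0 `|` Q 1) `|` (Q 2 `|` Q 3).
  move=> t [Et]; rewrite /Q /= !in_itv /= => /andP[t0 t2pi].
  have [t1|t1] := leP t (1%:R * (pi / 2)).
    by left; left; split=> //; rewrite mul0r t0.
  have [t2|t2] := leP t (2%:R * (pi / 2)); first by left; right; rewrite ltW.
  have [t3|t3] := leP t (3%:R * (pi / 2)); first by right; left; rewrite ltW.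
  by right; right; rewrite ltW//=; split=> //; lra.
rewrite /disk_arclength /pushforward /mrestr.
apply: (@le_trans _ _ (lebesgue_measure ((Q 0 `|` Q 1) `|` (Q 2 `|` Q 3)))).
  apply: le_measure => //; rewrite inE.
    by apply: measurableI; [exact: mE|exact: measurable_itv].
  by apply: measurableU; apply: measurableU; exact: mQ.
rewrite (_ : 64 * rho = (16 * rho + 16 * rho) + (16 * rho + 16 * rho));
  last by ring.
rewrite !EFinD.
have measU j k : measurable (Q j `|` Q k) by apply: measurableU; exact: mQ.
have measU_le j k :
    (lebesgue_measure (Q j `|` Q k) <= (16 * rho)%:E + (16 * rho)%:E)%E.
  by apply: le_trans (leeD (Qle j) (Qle k)); apply: measureU2; exact: mQ.
apply: le_trans (leeD (measU_le _ _) (measU_le _ _)).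
by apply: measureU2; exact: measU.
Qed.

End arclength.

(** * Real-valued integrals: almost everywhere equality and small supports *)

Section Rintegral_complements.
Context d (T : measurableType d) (R : realType).
Context (mu : {measure set T -> \bar R}).
Implicit Types (D A : set T) (f g : T -> R).

Lemma ae_eq_Rintegral D f g : measurable D ->
  measurable_fun D f -> measurable_fun D g -> f = g %[ae mu in D] ->
  \int[mu]_(x in D) f x = \int[mu]_(x in D) g x.
Proof.
move=> mD mf mg fg; rewrite /Rintegral; congr fine; apply: ae_eq_integral => //.
- exact/measurable_EFinP.
- exact/measurable_EFinP.
- by apply: filterS fg => x fgx Dx; rewrite fgx.
Qed.

(** The integral reduces to the intersection of [D] and [A], of measure at most [m], where [f] is
    integrable because it is bounded. This yields every estimate of the form sup norm times length
    of the support. *)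
Lemma normr_Rintegral_le_bound D A f (B m : R) :
  measurable D -> measurable A -> measurable_fun D f -> 0 <= B ->
  (mu A <= m%:E)%E -> (forall x, D x -> `|f x| <= B) ->
  (forall x, D x -> f x != 0 -> A x) ->
  `|\int[mu]_(x in D) f x| <= B * m.
Proof.
move=> mD mA mf B0 muA fB fA.
have mDA : measurable (D `&` A) by exact: measurableI.
have muDA : (mu (D `&` A) <= m%:E)%E.
  by apply: le_trans muA; apply: le_measure; rewrite ?inE.
have mfDA : measurable_fun (D `&` A) f.
  exact: measurable_funS (@subIsetl _ _ _) mf.
have fDA : mu.-integrable (D `&` A) (EFin \o f).
  apply: measurable_bounded_integrable => //.
    by apply: le_lt_trans muDA _; rewrite ltry.
  exists B; split; first exact: num_real.
  by move=> y By x [Dx _] /=; apply: le_trans (ltW By); exact: fB.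
have -> : \int[mu]_(x in D) f x = \int[mu]_(x in D `&` A) f x.
  rewrite Rintegral_mkcondr; apply: eq_Rintegral => x; rewrite inE => Dx.
  rewrite patchE; case: ifPn => // /negP xA; apply/eqP/negPn/negP => fx0.
  by apply: xA; rewrite inE; exact: fA.
rewrite -lee_fin EFin_normr_Rintegral//.
apply: le_trans (le_abse_integral _ _ _) _ => //; first exact/measurable_EFinP.
apply: le_trans (@integral_le_bound _ _ _ _ _ _ B%:E _ _ _ _) _ => //.
- exact/measurable_EFinP.
- by apply/aeW => x [Dx _] /=; rewrite lee_fin; exact: fB.
- by rewrite EFinM lee_pmul.
Qed.

End Rintegral_complements.

(** * The Neumann-Poincare operator on the unit circle *)

Section neumann_poincare_disk.
Variables (R : realType) (c : R * R).
Local Notation ds := (disk_arclength c).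
Local Notation K := (neumann_poincare (unit_disk c) (disk_normal c) ds).
Implicit Types (x y : R * R) (f g h F : R * R -> R).

Lemma measurable_unit_circle : measurable (unit_circle c).
Proof.
have mdot : measurable_fun setT (fun x => dot (x - c) (x - c)).
  by apply: measurable_funD; apply: measurable_funM;
    apply: measurable_funB => //.
rewrite -[unit_circle c]setTI (_ : unit_circle c =
  (fun x => dot (x - c) (x - c)) @^-1` [set 1])//.
by apply: mdot.
Qed.

Lemma unit_circleP x : unit_circle c x <->
   (x.1 - c.1) ^+ 2 + (x.2 - c.2) ^+ 2 = 1.
Proof. by rewrite /unit_circle /dot. Qed.

Lemma disk_param_unit_circle t : unit_circle c (disk_param c t).
Proof.
apply/unit_circleP; rewrite /disk_param /=.
by rewrite !(addrC _.1) !(addrC _.2) !addrK cos2Dsin2.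
Qed.

Lemma disk_arclength_circle : ds (unit_circle c) = (2 * pi)%:E.
Proof.
rewrite /disk_arclength /pushforward /mrestr.
rewrite (_ : disk_param c @^-1` unit_circle c = setT); last first.
  by apply/seteqP; split=> // t _; exact: disk_param_unit_circle.
rewrite setTI lebesgue_measure_itv /= lte_fin ifT ?sube0//.
by rewrite mulr_gt0// pi_gt0.
Qed.

(** The measure lives on the whole plane but is carried by the circle. Its finite total mass makes
    L^2 functions integrable. *)
Lemma disk_arclength_setT_fin_num : ds setT \is a fin_num.
Proof.
suff -> : ds setT = ds (unit_circle c) by rewrite disk_arclength_circle.
rewrite /disk_arclength /pushforward /mrestr.
congr (lebesgue_measure (_ `&` _)).
by apply/seteqP; split=> // t _; exact: disk_param_unit_circle.
Qed.

Lemma box0 x : box x 0 = [set x].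
Proof.
apply/seteqP; split=> [y|y ->]; rewrite /box /= ?subrr ?normr0//.
rewrite !normr_le0 !subr_eq0 => -[/eqP y1 /eqP y2].
by rewrite (surjective_pairing y) y1 y2 -surjective_pairing.
Qed.

(** A point is a square of half-side 0, and the bound on squares is linear in the half-side. *)
Lemma disk_arclength_set1 x : ds [set x] = 0.
Proof.
have := disk_arclength_box c x (lexx 0); rewrite mulr0 box0 => xbox.
by apply/eqP; rewrite eq_le measure_ge0 andbT.
Qed.

(** For unit vectors u = x - c and v = y - c, |u - v|^2 = 2 - 2 <u, v> = 2 <u - v, u>. *)
Lemma neumann_poincare_kernel x y :
  unit_circle c x -> unit_circle c y -> y != x ->
  dot (x - y) (disk_normal c x) / dot (x - y) (x - y) = 2^-1.
Proof.
move=> /unit_circleP cx /unit_circleP cy yx.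
have dotE : dot (x - y) (x - y) = 2 * dot (x - y) (disk_normal c x).
  by move: cx cy; rewrite /dot /disk_normal /=; nra.
have dot0 : dot (x - y) (x - y) != 0.
  apply: contra yx; rewrite /dot /= -!expr2 paddr_eq0 ?sqr_ge0//.
  rewrite !sqrf_eq0 !subr_eq0 => /andP[/eqP x1 /eqP x2].
  by rewrite (surjective_pairing x) x1 x2 -surjective_pairing.
by move: dot0; rewrite dotE mulf_eq0 negb_or => /andP[_ d0]; field.
Qed.

(** At y = x the numerator of the kernel is 0, so that point can be removed from the domain; it is
    put back afterwards because points are null. The constant is (2 pi)^-1 times the kernel value
    1/2. *)
Lemma neumann_poincare_unit_disk h x : unit_circle c x ->
  ds.-integrable (unit_circle c) (EFin \o h) ->
  K h x = (4 * pi)^-1 * \int[ds]_(y in unit_circle c) h y.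
Proof.
move=> cx ih; rewrite /neumann_poincare boundary_unit_disk.
have mC := measurable_unit_circle.
have mx : measurable [set x] by rewrite -box0; exact: measurable_box.
have -> : \int[ds]_(y in unit_circle c)
    (dot (x - y) (disk_normal c x) / dot (x - y) (x - y) * h y) =
    \int[ds]_(y in unit_circle c `&` ~` [set x]) (2^-1 * h y).
  rewrite Rintegral_mkcondr; apply: eq_Rintegral => y; rewrite inE => cy.
  rewrite patchE; case: ifPn; rewrite ?inE.
    by move=> /eqP yx; rewrite neumann_poincare_kernel.
  by rewrite notin_setE => /contrapT ->; rewrite subrr /dot !mul0r addr0 !mul0r.
have -> : \int[ds]_(y in unit_circle c `&` ~` [set x]) (2^-1 * h y) =
    \int[ds]_(y in unit_circle c) (2^-1 * h y).
  rewrite /Rintegral -setDE -negligible_integral//.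
    by have := integrableZl mC 2^-1 ih.
  exact: disk_arclength_set1.
rewrite RintegralZl// mulrA -invfM; congr (_^-1 * _); lra.
Qed.

(** On the circle the resolvent equation reads lambda h - k = F with k = (4 pi)^-1 m and m the
    integral of h. Integrating it alone and against g gives two relations, from which m is
    eliminated. The factor lambda - 1/2 stays on both sides, which avoids dividing by it. *)
Lemma np_resolvent_pairing lambda F g h :
  ds.-integrable (unit_circle c) (EFin \o F) ->
  measurable_fun (unit_circle c) g ->
  [bounded g x | x in unit_circle c] ->
  np_resolvent_graph (unit_disk c) (disk_normal c) ds lambda F h ->
  (lambda - 2^-1) * (lambda * \int[ds]_(x in unit_circle c) (g x * h x)) =
  (lambda - 2^-1) * \int[ds]_(x in unit_circle c) (g x * F x) +
  (4 * pi)^-1 * (\int[ds]_(x in unit_circle c) F x) *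
    (\int[ds]_(x in unit_circle c) g x).
Proof.
move=> iF mg bg [hL2]; rewrite boundary_unit_disk => hF.
have mC := measurable_unit_circle.
have finC : (ds (unit_circle c) < +oo)%E by rewrite disk_arclength_circle ltry.
have ih : ds.-integrable (unit_circle c) (EFin \o h).
  apply: (@integrableS _ _ _ _ setT) => //.
  apply/Lfun1_integrable; apply: Lfun_subset12 hL2.
  exact: disk_arclength_setT_fin_num.
set m := \int[ds]_(x in unit_circle c) h x.
pose k := (4 * pi)^-1 * m.
have hFk : (fun x => lambda * h x - k) = F %[ae ds in unit_circle c].
  by apply: filterS hF => x hFx cx; rewrite -hFx// neumann_poincare_unit_disk.
have ilh : ds.-integrable (unit_circle c) (EFin \o (fun x => lambda * h x)).
  by have := integrableZl mC lambda ih.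
have ik : ds.-integrable (unit_circle c) (EFin \o (fun=> k)).
  by apply: measurable_bounded_integrable => //; exact: bounded_cst.
have ilhk :
    ds.-integrable (unit_circle c) (EFin \o (fun x => lambda * h x - k)).
  by have := integrableB mC ilh ik.
have mfun f : ds.-integrable (unit_circle c) (EFin \o f) ->
    measurable_fun (unit_circle c) f.
  by move=> /measurable_int/measurable_EFinP.
have ig : ds.-integrable (unit_circle c) (EFin \o g).
  exact: measurable_bounded_integrable.
have igh : ds.-integrable (unit_circle c) (EFin \o (fun x => g x * h x)).
  by have := integrableMr mC mg bg ih.
have FE : \int[ds]_(x in unit_circle c) F x = (lambda - 2^-1) * m.
  (* The circle has length 2 pi, so the constant k integrates to m / 2. *)
  rewrite -(ae_eq_Rintegral mC (mfun _ ilhk) (mfun _ iF) hFk) RintegralB//.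
  rewrite RintegralZl// Rintegral_cst// [X in fine X]disk_arclength_circle /=.
  rewrite -/m /k.
  by move: pi (pi_gt0 R) => q q0; field; rewrite gt_eqF.
have gFE : \int[ds]_(x in unit_circle c) (g x * F x) =
    lambda * \int[ds]_(x in unit_circle c) (g x * h x) -
    k * \int[ds]_(x in unit_circle c) g x.
  have <- : \int[ds]_(x in unit_circle c) (lambda * (g x * h x) - k * g x) =
      \int[ds]_(x in unit_circle c) (g x * F x).
    apply: ae_eq_Rintegral => //.
    - apply: measurable_funB; apply: measurable_funM => //.
      exact: (measurable_funM mg (mfun _ ih)).
    - exact: (measurable_funM mg (mfun _ iF)).
    - by apply: filterS hFk => x hFx cx; rewrite -hFx//; ring.
  rewrite RintegralB ?RintegralZl//.
  - by have := integrableZl mC lambda igh.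
  - by have := integrableZl mC k ig.
by rewrite FE gFE /k; ring.
Qed.

End neumann_poincare_disk.

(** * Topological supports and compactly supported functions *)

Section supports.
Context (R : realType) (V : normedModType R).
Implicit Types f g : V -> R.

Lemma subset_tsupp f x : f x != 0 -> tsupp f x.
Proof. by move=> fx; exact: (@subset_closure _ [set y | f y != 0]). Qed.

(** The complement of the topological support is open, so off the support f vanishes near x and its
    directional derivatives are 0. *)
Lemma derive_neq0_tsupp f v x : 'D_v f x != 0 -> tsupp f x.
Proof.
move=> Dfx; apply: contrapT => xf; move/negP: Dfx; apply; apply/eqP.
have nbhs_x : nbhs x (~` tsupp f).
  apply: open_nbhs_nbhs; split=> //; apply: closed_openC.
  exact: (@closed_closure _ [set y | f y != 0]).
rewrite (@near_eq_derive _ _ _ f (cst 0)) ?derive_cst//.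
apply: filterS nbhs_x => y yf; apply/eqP/negPn/negP => fy.
by apply: yf; exact: subset_tsupp.
Qed.

(** Meant for g = f and for g = f', both of which vanish off the support of f. *)
Lemma compact_tsupp_bounded f g : continuous g -> compact (tsupp f) ->
  (forall x, g x != 0 -> tsupp f x) -> exists M, forall x, `|g x| <= M.
Proof.
move=> gC fK gf.
have : compact (g @` tsupp f).
  by apply: continuous_compact fK; exact: continuous_subspaceT.
(* Boundedness holds for every constant strictly above [M], hence [M + 1]; the maximum with 0 serves
   the points where g vanishes. *)
move=> /compact_bounded[M [_ MB]]; exists (Num.max (M + 1) 0) => x.
have [->|gx0] := eqVneq (g x) 0; first by rewrite normr0 le_max lexx orbT.
rewrite le_max MB//; first by rewrite ltrDl.
by exists x => //; exact: gf.
Qed.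

End supports.

Lemma C1_compact_bounds (R : realType) (r : nat) (phi : R -> R) :
  (1 < r)%N -> Cclass_compact r phi ->
  [/\ forall t, derivable phi t 1, continuous phi, continuous (derive1 phi)
    & exists A M : R, [/\ 0 <= A, 0 <= M,
        forall t, `|phi t| <= M /\ `|derive1 phi t| <= M
      & forall t, (phi t != 0) || (derive1 phi t != 0) -> `|t| <= A]].
Proof.
move=> r1 [[dphi _] phiK].
have cont (f : R -> R) : (forall t, derivable f t 1) -> continuous f.
  by move=> df t; exact/differentiable_continuous/derivable1_diffP.
have dphi0 : forall t, derivable phi t 1 by apply: (dphi 0%N); exact: ltnW.
have cphi := cont _ dphi0.
(* Since r >= 2, the first derivative is itself differentiable, hence continuous. *)
have cphi' : continuous (derive1 phi) by exact/cont/(dphi 1%N).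
have supp' t : derive1 phi t != 0 -> tsupp phi t.
  by rewrite derive1E; exact: derive_neq0_tsupp.
split=> //.
have [A [_ AB]] := compact_bounded phiK.
have [M1 M1P] := compact_tsupp_bounded cphi phiK (@subset_tsupp _ _ phi).
have [M2 M2P] := compact_tsupp_bounded cphi' phiK supp'.
exists (`|A| + 1), (Num.max M1 M2); split.
- by rewrite addr_ge0.
- by rewrite le_max (le_trans _ (M1P 0)).
- by move=> t; rewrite !le_max M1P M2P orbT.
- move=> t phit; apply: AB; first by rewrite ltr_pwDr// ler_norm.
  by case/orP: phit => [/subset_tsupp|/supp'].
Qed.

(** * Derivatives and measurability of the dilated scaling functions *)

Section scaling_function.
Context (R : realType) (phi : R -> R).
Implicit Types (L : int) (n : int * int) (c x v : R * R).

(** The directional derivative is the derivative at h = 0 of the one-variable function h |->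
    phi_{L,n}(x + h v). One factor 2^-L comes from the normalisation, the other from the chain
    rule. *)
Lemma derive_phiLn L n v x : (forall t, derivable phi t 1) ->
  'D_v (phiLn phi L n) x =
  (2 ^ (- L)) ^+ 2 *
  (v.1 * (derive1 phi (2 ^ (- L) * x.1 - n.1%:~R) *
          phi (2 ^ (- L) * x.2 - n.2%:~R)) +
   v.2 * (phi (2 ^ (- L) * x.1 - n.1%:~R) *
          derive1 phi (2 ^ (- L) * x.2 - n.2%:~R))).
Proof.
move=> dphi; rewrite /phiLn /phi2 /=; set a := 2 ^ (- L).
pose g (h : R) := a * (phi (a * (h * v.1 + x.1) - n.1%:~R) *
                       phi (a * (h * v.2 + x.2) - n.2%:~R)).
have -> : 'D_v (fun y : R * R =>
    a * (phi (a * y.1 - n.1%:~R) * phi (a * y.2 - n.2%:~R))) x = 'D_1 g 0.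
  rewrite /derive; apply: (congr1 (fun q : R -> R => lim (q h @[h --> 0^']))).
  by apply/funext => h; rewrite /g /= addr0 !mul0r !add0r /GRing.scale /= mulr1.
have dg (b w m : R) : is_derive (0 : R) 1 (fun h => phi (a * (h * w + b) - m))
    (derive1 phi (a * b - m) * (a * w)).
  apply: (@is_derive1_comp _ phi (fun h => a * (h * w + b) - m)).
    by rewrite mul0r add0r derive1E; exact: DeriveDef.
  suff : is_derive (0 : R) 1
      (cst a * (id * cst w + cst b) - cst m : R -> R) (a * w) by [].
  by apply: is_derive_eq; rewrite /= /GRing.scale /= /cst; ring.
have dag : is_derive (0 : R) 1 g (a * (phi (a * x.1 - n.1%:~R) *
    (derive1 phi (a * x.2 - n.2%:~R) * (a * v.2)) +
    phi (a * x.2 - n.2%:~R) * (derive1 phi (a * x.1 - n.1%:~R) * (a * v.1)))).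
  have := is_deriveZ a (is_deriveM (dg x.1 v.1 n.1%:~R) (dg x.2 v.2 n.2%:~R)).
  by rewrite !mul0r !add0r.
by rewrite (@derive_val _ _ _ _ _ _ _ dag); ring.
Qed.

Lemma phiLn_neq0 L n x : phiLn phi L n x != 0 ->
  phi (2 ^ (- L) * x.1 - n.1%:~R) != 0 /\ phi (2 ^ (- L) * x.2 - n.2%:~R) != 0.
Proof. by rewrite /phiLn /phi2 /= !mulf_eq0 !negb_or => /and3P[]. Qed.

Lemma measurable_dilate (psi : R -> R) (a b : R) : continuous psi ->
  measurable_fun [set: R] (fun t => psi (a * t - b)).
Proof.
move=> psiC; apply: continuous_measurable_fun => t.
apply: continuous_comp; last exact: psiC.
by apply: cvgB; [apply: cvgMr; exact: cvg_id|exact: cvg_cst].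
Qed.

Lemma measurable_phiLn L n : continuous phi ->
  measurable_fun setT (phiLn phi L n).
Proof.
move=> phiC; apply: measurable_funM => //; apply: measurable_funM.
- exact: (measurableT_comp (measurable_dilate _ _ phiC) measurable_fst).
- exact: (measurableT_comp (measurable_dilate _ _ phiC) measurable_snd).
Qed.

Lemma measurable_normal_derivative_phiLn c L n :
  (forall t, derivable phi t 1) -> continuous phi -> continuous (derive1 phi) ->
  measurable_fun setT (normal_derivative (disk_normal c) (phiLn phi L n)).
Proof.
move=> dphi phiC phi'C.
have /funext dE := fun x => derive_phiLn L n (disk_normal c x) x dphi.
rewrite /normal_derivative dE.
apply: measurable_funM => //; apply: measurable_funD; apply: measurable_funM;
  (try by apply: measurable_funB); apply: measurable_funM.
- exact: (measurableT_comp (measurable_dilate _ _ phi'C) measurable_fst).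
- exact: (measurableT_comp (measurable_dilate _ _ phiC) measurable_snd).
- exact: (measurableT_comp (measurable_dilate _ _ phiC) measurable_fst).
- exact: (measurableT_comp (measurable_dilate _ _ phi'C) measurable_snd).
Qed.

End scaling_function.

(** * Sup bounds and supporting squares at scale L *)

Section wavelet_estimates.
Context (R : realType) (c : R * R) (phi : R -> R) (A M : R)
  (dphi : forall t, derivable phi t 1)
  (phi_le : forall t, `|phi t| <= M /\ `|derive1 phi t| <= M)
  (phi_supp : forall t, (phi t != 0) || (derive1 phi t != 0) -> `|t| <= A).
Implicit Types (L : int) (n : int * int) (x : R * R).

(** With a = 2^-L, this is the preimage of the square |t1|, |t2| <= A under x |-> a x - n. It serves
    both phi_{L,n} and its normal derivative. *)
Let support_box L n : set (R * R) :=
  box (n.1%:~R / 2 ^ (- L), n.2%:~R / 2 ^ (- L)) (A / 2 ^ (- L)).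
Let dphiLn L n := normal_derivative (disk_normal c) (phiLn phi L n).

Lemma scale_gt0 L : 0 < 2 ^ (- L) :> R.
Proof. exact: exprz_gt0. Qed.

Lemma dilate_le a m t : 0 < a -> `|a * t - m| <= A -> `|t - m / a| <= A / a.
Proof.
move=> a0 tA; rewrite ler_pdivlMr// -[X in _ * X]gtr0_norm// -normrM.
by rewrite mulrBl divfK ?gt_eqF// mulrC.
Qed.

Lemma normr_phiLn_le L n x : `|phiLn phi L n x| <= 2 ^ (- L) * M ^+ 2.
Proof.
rewrite /phiLn /phi2 !normrM gtr0_norm ?scale_gt0// ler_pM2l ?scale_gt0//.
by rewrite expr2 ler_pM// (phi_le _).1.
Qed.

Lemma phiLn_support L n x : phiLn phi L n x != 0 -> support_box L n x.
Proof.
have a0 := scale_gt0 L.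
by move=> /phiLn_neq0[p1 p2]; split; apply: dilate_le => //; apply: phi_supp;
  rewrite ?p1 ?p2.
Qed.

(** On the circle both coordinates of the normal x - c are at most 1 in absolute value, so each of
    the two terms of the derivative is at most a^2 M^2, where a = 2^-L. *)
Lemma normr_normal_derivative_phiLn_le L n x : unit_circle c x ->
  `|dphiLn L n x| <= (2 ^ (- L)) ^+ 2 * (2 * M ^+ 2).
Proof.
move=> /unit_circleP cx.
have M0 : 0 <= M by exact: le_trans (phi_le 0).1.
have nu1 : `|x.1 - c.1| <= 1.
  by rewrite -(@expr_le1 _ 2)// real_normK ?num_real// -cx lerDl sqr_ge0.
have nu2 : `|x.2 - c.2| <= 1.
  by rewrite -(@expr_le1 _ 2)// real_normK ?num_real// -cx lerDr sqr_ge0.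
have bnd (v p q : R) : `|v| <= 1 -> `|p| <= M -> `|q| <= M ->
    `|v * (p * q)| <= M ^+ 2.
  move=> v1 pM qM; rewrite 2!normrM -[leRHS]mul1r expr2.
  by rewrite !ler_pM// mulr_ge0.
rewrite /dphiLn /normal_derivative derive_phiLn// normrM.
rewrite ger0_norm ?sqr_ge0// ler_pM2l ?exprn_gt0 ?scale_gt0//.
rewrite mulr_natl mulr2n (le_trans (ler_normD _ _))// lerD//.
  exact: bnd (phi_le _).2 (phi_le _).1.
exact: bnd (phi_le _).1 (phi_le _).2.
Qed.

(** Each term of the derivative has, for either coordinate, a factor phi or phi'. If both vanish at
    one coordinate, the whole sum is 0. *)
Lemma normal_derivative_phiLn_support L n x :
  dphiLn L n x != 0 -> support_box L n x.
Proof.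
have a0 := scale_gt0 L.
rewrite /dphiLn /normal_derivative derive_phiLn// mulf_eq0 negb_or => /andP[_].
set p1 := phi (_ - n.1%:~R); set q1 := derive1 phi (_ - n.1%:~R).
set p2 := phi (_ - n.2%:~R); set q2 := derive1 phi (_ - n.2%:~R) => N0.
have H1 : (p1 != 0) || (q1 != 0).
  by apply: contraR N0; rewrite negb_or !negbK => /andP[/eqP-> /eqP->];
    rewrite !(mul0r, mulr0) addr0.
have H2 : (p2 != 0) || (q2 != 0).
  by apply: contraR N0; rewrite negb_or !negbK => /andP[/eqP-> /eqP->];
    rewrite !(mul0r, mulr0) addr0.
by split; apply: dilate_le => //; exact: phi_supp.
Qed.

End wavelet_estimates.

Theorem proposition4p2 (R : realType) (c : R * R) (kappa : R)
  (kappa_gt0 : 0 < kappa) (kappa_neq1 : kappa != 1)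
  (r : nat) (r_ge2 : (2 <= r)%N) (V : int -> set (R -> R)) (phit psit : R -> R)
  (phit_Cr : Cclass_compact r phit)
  (V_mra : multiresolution V)
  (phit_scaling : orthonormal_scaling_function V phit)
  (psit_wavelet : associated_wavelet V psit)
  (p : nat) (p_gt2 : (2 < p)%N) (psit_moments : zero_moments p psit) :
  let T := np_form (unit_disk c) (disk_normal c) (disk_arclength c) kappa in
  let overlap (L : int) (n n' : int * int) :=
    tsupp (phiLn phit L n) `&` tsupp (phiLn phit L n') !=set0 in
  exists (C : R) (L0 : int), forall L : int, L <= L0 ->
    forall n n' : int * int,
      (overlap L n n' ->
         `|T (phiLn phit L n) (phiLn phit L n')| <= C * 2 ^ (- (2 * L))) /\
      (~ overlap L n n' ->
         `|T (phiLn phit L n) (phiLn phit L n')| <= C * 2 ^ (- L)).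
Proof.
move=> T overlap.
have [dphi phiC phi'C [A [M [A0 M0 phi_le phi_supp]]]] :=
  C1_compact_bounds r_ge2 phit_Cr.
set lambda := np_lambda kappa.
have kappa1 : kappa - 1 != 0 by rewrite subr_eq0.
(* The numerator kappa + 1 is positive because kappa > 0; the pairing identity is later divided by
   lambda. *)
have lambda0 : lambda != 0.
  by rewrite mulf_neq0 ?invr_neq0 ?mulf_neq0// gt_eqF// addr_gt0.
have lambdaB : lambda - 2^-1 = (kappa - 1)^-1.
  by rewrite /lambda /np_lambda; field.
(* [C1] is the constant in the bound of the integral of g F by a^2. [C2] multiplies |kappa - 1| (4
   pi)^-1 by the constants bounding the integrals of F (by a) and of g (by 1). *)
pose C1 := 128 * A * M ^+ 4.
pose C2 := `|kappa - 1| * (4 * pi)^-1 * (128 * A * M ^+ 2) * (64 * A * M ^+ 2).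
have C10 : 0 <= C1 by rewrite !mulr_ge0// exprn_ge0.
have C20 : 0 <= C2.
  by rewrite !mulr_ge0 ?exprn_ge0// invr_ge0 mulr_ge0// pi_ge0.
(* The threshold 0 ensures a = 2^-L >= 1, so that a <= a^2. *)
exists (`|lambda|^-1 * (C1 + C2)), 0 => L L0 n n'.
set a : R := 2 ^ (- L).
have a0 : 0 < a := scale_gt0 R L.
have a1 : 1 <= a by rewrite -(expr0z (2 : R)) ler_weXz2l ?ler1n// oppr_ge0.
have a2E : 2 ^ (- (2 * L)) = a ^+ 2 :> R.
  by rewrite mulr_natl mulr2n opprD expfzDr ?expr2// pnatr_eq0.
set f := phiLn phit L n; set g := phiLn phit L n'.
pose F := normal_derivative (disk_normal c) f.
pose S m : set (R * R) := box (m.1%:~R / a, m.2%:~R / a) (A / a).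
have S_le m : (disk_arclength c (S m) <= (64 * (A / a))%:E)%E.
  by apply: disk_arclength_box; rewrite divr_ge0// ltW.
have mC := measurable_unit_circle c.
have mF : measurable_fun (unit_circle c) F.
  by apply: measurable_funTS; exact: measurable_normal_derivative_phiLn.
have mg : measurable_fun (unit_circle c) g.
  by apply: measurable_funTS; exact: measurable_phiLn.
have gB x : `|g x| <= a * M ^+ 2 by exact: normr_phiLn_le.
have FB x : unit_circle c x -> `|F x| <= a ^+ 2 * (2 * M ^+ 2).
  exact: normr_normal_derivative_phiLn_le.
have FS x : F x != 0 -> S n x by exact: normal_derivative_phiLn_support.
have gS x : g x != 0 -> S n' x by exact: phiLn_support.
have M20 : 0 <= M ^+ 2 by exact: exprn_ge0.
set IgF := \int[disk_arclength c]_(x in unit_circle c) (g x * F x).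
(* The product g F is O(a^3) and vanishes off the square of F, which meets the circle in length at
   most 64 A / a. *)
have IgF_le : `|IgF| <= C1 * a ^+ 2.
  have -> : C1 * a ^+ 2 = a ^+ 3 * (2 * M ^+ 4) * (64 * (A / a)).
    by rewrite /C1; field; rewrite gt_eqF.
  apply: (normr_Rintegral_le_bound mC (measurable_box _ _) _ _ (S_le n)) => //.
  - exact: measurable_funM.
  - by rewrite !mulr_ge0 ?exprn_ge0// ltW.
  - move=> x cx; rewrite normrM.
    rewrite (_ : _ ^+ 3 * _ = (a * M ^+ 2) * (a ^+ 2 * (2 * M ^+ 2)));
      last by ring.
    by rewrite ler_pM// FB.
  - by move=> x _; rewrite mulf_eq0 negb_or => /andP[_]; exact: FS.
set IF := \int[disk_arclength c]_(x in unit_circle c) F x.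
have IF_le : `|IF| <= 128 * A * M ^+ 2 * a.
  have -> : 128 * A * M ^+ 2 * a = a ^+ 2 * (2 * M ^+ 2) * (64 * (A / a)).
    by field; rewrite gt_eqF.
  apply: (normr_Rintegral_le_bound mC (measurable_box _ _) _ _ (S_le n)) => //.
    by rewrite !mulr_ge0 ?exprn_ge0// ltW.
  by move=> x _; exact: FS.
set Ig := \int[disk_arclength c]_(x in unit_circle c) g x.
have Ig_le : `|Ig| <= 64 * A * M ^+ 2.
  have -> : 64 * A * M ^+ 2 = a * M ^+ 2 * (64 * (A / a)).
    by field; rewrite gt_eqF.
  apply: (normr_Rintegral_le_bound mC (measurable_box _ _) _ _ (S_le n')) => //.
    by rewrite mulr_ge0// ltW.
  by move=> x _; exact: gS.
(* This bound serves both cases, which differ only in the size of the integral of g F. *)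
have T_le : `|T f g| <= `|lambda|^-1 * (`|IgF| + C2 * a).
  rewrite /T /np_form boundary_unit_disk -/F /np_resolvent.
  case: xgetP => [h _ hgraph|_]; last first.
    (* An empty resolvent graph would make [xget] return 0. *)
    rewrite (@eq_Rintegral _ _ _ _ _ (fun=> 0)); last first.
      by move=> x _; rewrite mulr0.
    by rewrite Rintegral_cst// mul0r normr0 mulr_ge0 ?invr_ge0// addr_ge0//
      mulr_ge0// ltW.
  have finC : (disk_arclength c (unit_circle c) < +oo)%E.
    by rewrite disk_arclength_circle ltry.
  have bounded_on (q : R * R -> R) B :
      (forall x, unit_circle c x -> `|q x| <= B) ->
      [bounded q x | x in unit_circle c].
    move=> qB; exists B; split; first exact: num_real.
    by move=> y By x cx /=; apply: le_trans (ltW By); exact: qB.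
  have iF : (disk_arclength c).-integrable (unit_circle c) (EFin \o F).
    by apply: measurable_bounded_integrable => //; exact: bounded_on FB.
  have bg : [bounded g x | x in unit_circle c].
    by apply: (bounded_on _ (a * M ^+ 2)) => x _.
  have := np_resolvent_pairing iF mg bg hgraph.
  rewrite -/IgF -/IF -/Ig -/lambda lambdaB.
  set I := \int[_]_(_ in _) _ => TE.
  (* The pairing identity is multiplied by kappa - 1, the inverse of lambda - 1/2, and solved for
     the integral of g h. *)
  have -> : I = lambda^-1 * (IgF + (kappa - 1) * ((4 * pi)^-1 * IF * Ig)).
    move: (4 * pi)^-1 TE => q TE.
    have -> : IgF = lambda * I - (kappa - 1) * (q * IF * Ig).
      by apply: (mulfI (invr_neq0 kappa1)); rewrite mulrBr TE mulKf//; ring.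
    by field.
  rewrite normrM normfV ler_pM2l ?invr_gt0 ?normr_gt0//.
  rewrite (le_trans (ler_normD _ _))// lerD2l !normrM.
  rewrite (ger0_norm (_ : 0 <= (4 * pi)^-1)) ?invr_ge0 ?mulr_ge0 ?pi_ge0//.
  rewrite (_ : C2 * a = `|kappa - 1| * ((4 * pi)^-1 * (128 * A * M ^+ 2 * a) *
    (64 * A * M ^+ 2))); last by rewrite /C2; ring.
  by rewrite ler_wpM2l// ler_pM ?mulr_ge0 ?invr_ge0 ?mulr_ge0 ?pi_ge0//
    ler_wpM2l// invr_ge0 mulr_ge0// pi_ge0.
split=> [_|sep]; apply: le_trans T_le _; rewrite -[leRHS]mulrA;
  (apply: ler_wpM2l; first by rewrite invr_ge0); rewrite mulrDl.
  (* The O(a) term is absorbed using a <= a^2. *)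
  by rewrite a2E lerD// ler_wpM2l// expr2 ler_peMl// ltW.
(* A point where g and F are both nonzero would lie in both topological supports, since F is a
   directional derivative of f. *)
have -> : IgF = 0.
  rewrite /IgF (@eq_Rintegral _ _ _ _ _ (fun=> 0)) ?Rintegral_cst ?mul0r//.
  move=> x _ /=.
  apply/eqP; rewrite mulf_eq0; apply/negPn/negP; rewrite negb_or.
  move=> /andP[gx Fx].
  apply: sep; exists x; split; last exact: subset_tsupp.
  exact: derive_neq0_tsupp Fx.
by rewrite normr0 add0r lerDr mulr_ge0// ltW.
Qed.
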